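(* Let $k,l,m\ge1$ and let $X,Y$ be pointed finite CW-complexes. For all integers $r,s\ge0$, the composition map $G_{k,l}(X)\wedge G_{l,m}(Y)\to G_{k,m}(X\wedge Y)$ restricts to a natural map $$G_{k,l,r}(X)\wedge G_{l,m,s}(Y)\to G_{k,m,rs}(X\wedge Y).$$
   Context: $M_k$ is the $C^*$-algebra of $k\times k$ complex matrices. For a pointed finite CW-complex $X$, $C_0(X,M_l)$ is the $C^*$-algebra of continuous maps $X\to M_l$ sending the basepoint to $0$. $G_{k,l}(X)$ is the space of all (not necessarily unital) $*$-homomorphisms $C_0(X,M_l)\to M_k$ with the topology of pointwise norm convergence, pointed by the zero homomorphism; it is covariantly functorial in $X$. For $f\in G_{k,l}(X)$ with image $A_f\subseteq M_k$ put $V_f=A_f\cdot\mathbb C^k\subseteq\mathbb C^k$; then $l\mid\dim V_f$ and $\mathrm{rank}(f):=\dim V_f/l$. $G_{k,l,r}(X)\subseteq G_{k,l}(X)$ is the subspace of $f$ with $\mathrm{rank}(f)\le r$ (a subfunctor). The composition map sends $f\wedge g$, with $f:C_0(X,M_l)\to M_k$ and $g:C_0(Y,M_m)\to M_l$, to the composite $$C_0(X\wedge Y,M_m)\cong C_0(X,C_0(Y,M_m))\xrightarrow{\,C_0(X,g)\,}C_0(X,M_l)\xrightarrow{\,f\,}M_k.$$ *)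

(* Defs.v *)
From HB Require Import structures.
From mathcomp Require Import all_boot all_order all_algebra.
From mathcomp Require Import generic_quotient.
From mathcomp Require Import all_classical all_reals all_analysis.
From mathcomp.real_closed Require Import complex.

Set Implicit Arguments.
Unset Strict Implicit.
Unset Printing Implicit Defensive.
Import Order.TTheory GRing.Theory Num.Theory numFieldNormedType.Exports.
Local Open Scope classical_set_scope.
Local Open Scope quotient_scope.
Local Open Scope ring_scope.

(* The complex numbers, typed as a numClosedFieldType so that the topology that
   numFieldNormedType attaches to such fields is found on [Cplx R] and on
   matrices over it. *)
Definition Cplx (R : realType) : numClosedFieldType := R[i].

Lemma mx_cvg (K : numFieldType) m n (T : Type) (F : set_system T)
    (FF : Filter F) (f : T -> 'M[K]_(m, n)) (M : 'M[K]_(m, n)) :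
  (forall i j, (fun x => f x i j) @ F --> M i j) -> f @ F --> M.
Proof.
move=> h U [P hP sPU]; rewrite /= /nbhs /=.
apply: (@filterS _ F _ (fun x => forall i j, P i j (f x i j))).
  by move=> x hx; exact: sPU.
by apply: filter_forall => i; apply: filter_forall => j; exact/h/hP.
Qed.

Lemma mx_continuous (K : numFieldType) m n (T : topologicalType)
    (f : T -> 'M[K]_(m, n)) :
  (forall i j, continuous (fun x => f x i j)) -> continuous f.
Proof. by move=> h x; apply: mx_cvg => i j; exact: h. Qed.

Lemma continuous_entry (K : numFieldType) m n (T : topologicalType)
    (f : T -> 'M[K]_(m, n)) i j :
  continuous f -> continuous (fun x => f x i j).
Proof.
move=> cf x; apply: (@continuous_comp _ _ _ f (fun M : 'M[K]_(m, n) => M i j)).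
  exact: cf.
exact: coord_continuous.
Qed.

Lemma continuous_sumr (K : numFieldType) (I : Type) (s : seq I) (P : pred I)
    (T : topologicalType) (f : I -> T -> K) :
  (forall i, P i -> continuous (f i)) ->
  continuous (fun x => \sum_(i <- s | P i) f i x).
Proof.
move=> h x; apply: (@cvg_big _ _ +%R 0).
  exact: add_continuous.
by move=> i Pi; exact: h.
Qed.

Lemma continuous_prodr (K : numFieldType) (I : Type) (s : seq I) (P : pred I)
    (T : topologicalType) (f : I -> T -> K) :
  (forall i, P i -> continuous (f i)) ->
  continuous (fun x => \prod_(i <- s | P i) f i x).
Proof.
move=> h x; apply: (@cvg_big K I ( *%R : K -> K -> K) 1 P).
  exact: mul_continuous.
by move=> i Pi; exact: h.
Qed.

Lemma continuous_mulmx (K : numFieldType) m n p (T : topologicalType)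
    (f : T -> 'M[K]_(m, n)) (g : T -> 'M[K]_(n, p)) :
  continuous f -> continuous g -> continuous (fun x => f x *m g x).
Proof.
move=> cf cg; apply: mx_continuous => i j.
under eq_fun do rewrite mxE.
apply: continuous_sumr => k _ x.
by apply: cvgM; apply: continuous_entry.
Qed.

Lemma continuous_det (K : numFieldType) n (T : topologicalType)
    (f : T -> 'M[K]_n) : continuous f -> continuous (fun x => \det (f x)).
Proof.
move=> cf; apply: continuous_sumr => s _ x.
apply: cvgM; first exact: cvg_cst.
by apply: continuous_prodr => i _; exact: continuous_entry.
Qed.

Lemma continuous_adj (K : numFieldType) n (T : topologicalType)
    (f : T -> 'M[K]_n) : continuous f -> continuous (fun x => \adj (f x)).
Proof.
move=> cf; apply: mx_continuous => i j; under eq_fun do rewrite mxE.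
move=> x; apply: cvgM; first exact: cvg_cst.
apply: (@continuous_det _ _ _ (fun x => row' j (col' i (f x)))).
apply: mx_continuous => a b.
by under eq_fun do rewrite !mxE; exact: continuous_entry.
Qed.

Lemma continuous_conj (K : numClosedFieldType) (T : topologicalType)
    (f : T -> K) : continuous f -> continuous (fun x => (f x)^*).
Proof.
move=> cf x; apply/cvgrPdist_lt => e e0.
have /cvgrPdist_lt /(_ e e0) := cf x.
by apply: filterS => y; rewrite -rmorphB norm_conjC.
Qed.

Definition adjmx (K : numClosedFieldType) m n (A : 'M[K]_(m, n)) :
    'M[K]_(n, m) :=
  map_mx Num.conj A^T.

Lemma continuous_adjmx (K : numClosedFieldType) m n (T : topologicalType)
    (f : T -> 'M[K]_(m, n)) : continuous f -> continuous (fun x => adjmx (f x)).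
Proof.
move=> cf; apply: mx_continuous => i j; under eq_fun do rewrite !mxE.
by apply: continuous_conj; exact: continuous_entry.
Qed.

Section FunctionAlgebra.
Variables (R : realType) (X : ptopologicalType) (l : nat).

Definition C0_pred : {pred X -> 'M[Cplx R]_l} :=
  [pred f : X -> 'M[Cplx R]_l | `[< continuous f /\ f point = 0 >] ].

(* C_0(X, M_l). The norm of 'M[Cplx R]_l is the largest modulus of an entry; in
   finite dimension it gives the same topology as the C*-norm. *)
Record C0 := MkC0 { C0_fun :> X -> 'M[Cplx R]_l ; _ : C0_fun \in C0_pred }.

HB.instance Definition _ := [isSub for C0_fun].
HB.instance Definition _ := [Choice of C0 by <:].

Lemma C0_subproof (f : X -> 'M[Cplx R]_l) :
  continuous f -> f point = 0 -> f \in C0_pred.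
Proof. by move=> ? ?; apply/asboolP. Qed.

Definition mkC0 (f : X -> 'M[Cplx R]_l) (cf : continuous f)
    (f0 : f point = 0) : C0 :=
  MkC0 (C0_subproof cf f0).

Lemma C0_continuous (f : C0) : continuous f.
Proof. by case: f => f /= /asboolP[]. Qed.

Lemma C0_point (f : C0) : f point = 0.
Proof. by case: f => f /= /asboolP[]. Qed.

Lemma C0P (f g : C0) : f =1 g -> f = g.
Proof. by move=> fg; apply/val_inj/funext. Qed.

Lemma C0_submod_closed : submod_closed C0_pred.
Proof.
split; first by apply/asboolP; split => // x; exact: cvg_cst.
move=> a f g /asboolP[cf f0] /asboolP[cg g0]; apply/asboolP; split.
  by move=> x; apply: cvgD; [apply: cvgZr; exact: cf | exact: cg].
by rewrite !fctE /= f0 g0 scaler0 addr0.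
Qed.

HB.instance Definition _ :=
  GRing.isSubmodClosed.Build _ _ C0_pred C0_submod_closed.
HB.instance Definition _ := [SubChoice_isSubLmodule of C0 by <:].

Lemma C0_mul_point (f g : C0) : f point *m g point = 0.
Proof. by rewrite C0_point mul0mx. Qed.

Definition C0_mul (f g : C0) : C0 :=
  mkC0 (continuous_mulmx (@C0_continuous f) (@C0_continuous g))
    (C0_mul_point f g).

Lemma C0_star_point (f : C0) : adjmx (f point) = 0.
Proof. by rewrite C0_point /adjmx trmx0 map_mx0. Qed.

Definition C0_star (f : C0) : C0 :=
  mkC0 (continuous_adjmx (@C0_continuous f)) (C0_star_point f).

Definition star_hom k (F : C0 -> 'M[Cplx R]_k) : Prop :=
  [/\ linear F, forall a b, F (C0_mul a b) = F a *m F b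
    & forall a, F (C0_star a) = adjmx (F a)].

End FunctionAlgebra.

Lemma norm_mxtrace_le (K : numClosedFieldType) n (A : 'M[K]_n) :
  (forall a, eigenvalue A a -> `|a| <= 1) -> `|\tr A| <= n%:R.
Proof.
case: n A => [|n] A h; first by rewrite /mxtrace big_ord0 normr0.
have [rs Ers] := closed_field_poly_normal (char_poly A).
rewrite (monicP (char_poly_monic A)) scale1r in Ers.
have Srs : size rs = n.+1.
  by apply: succn_inj; rewrite -(size_char_poly A) Ers size_prod_XsubC.
have -> : \tr A = \sum_(r <- rs) r.
  apply: oppr_inj; rewrite -char_poly_trace // Ers -[n.+1 in LHS]Srs.
  by rewrite coefPn_prod_XsubC // Srs.
apply: le_trans (ler_norm_sum _ _ _) _.
rewrite -Srs -sum1_size natr_sum big_seq [leRHS]big_seq.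
apply: ler_sum => r rrs.
by apply: h; rewrite eigenvalue_root_char Ers root_prod_XsubC.
Qed.

Lemma det_scalar_sub_neq0 (K : numFieldType) n (B : 'M[K]_n) (a e : K) :
  (forall i j, `|B i j| <= e) -> n%:R * e < 1 -> 1 <= `|a| ->
  \det (a%:M - B) != 0.
Proof.
move=> Be ne1 a1; apply/det0P => -[v v0].
rewrite mulmxBr mul_mx_scalar => /eqP; rewrite subr_eq0 => /eqP Ev.
set S := \sum_j `|v 0 j|.
have S_gt0 : 0 < S.
  rewrite lt_neqAle sumr_ge0 // andbT eq_sym; apply: contra_neq v0.
  move=> /psumr_eq0P S0; apply/rowP => j; rewrite mxE.
  by apply/eqP; rewrite -normr_eq0 S0.
suff : `|a| * S < S by rewrite gtr_pMl // (le_gtF a1).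
apply: (@le_lt_trans _ _ (n%:R * e * S)); last by rewrite gtr_pMl.
rewrite [X in X <= _]mulr_sumr.
apply: (@le_trans _ _ (\sum_(j < n) (e * S))); last first.
  by rewrite sumr_const card_ord -mulrA mulr_natl.
apply: ler_sum => j _; rewrite -normrM.
have -> : a * v 0 j = (v *m B) 0 j by rewrite -Ev mxE.
rewrite mxE; apply: le_trans (ler_norm_sum _ _ _) _.
rewrite mulr_sumr; apply: ler_sum => i _.
by rewrite normrM mulrC ler_wpM2r.
Qed.

(* A *-homomorphism from C_0(X, M_l) to M_k is continuous at 0 for uniform
   convergence; its definition does not ask for this, and it is what makes the
   map C_0(X, g) below land in continuous functions. *)
Section AutomaticContinuity.
Variables (R : realType) (X : ptopologicalType) (l k : nat).
Variable g : C0 R X l -> 'M[Cplx R]_k.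
Hypothesis gP : star_hom g.

Lemma star_homB a b : g (a - b) = g a - g b.
Proof.
have [lg _ _] := gP; have := lg (-1) b a.
by rewrite !scaleN1r => E; rewrite addrC E addrC.
Qed.

Lemma star_homZ c a : g (c *: a) = c *: g a.
Proof.
have [lg _ _] := gP; have := lg c a 0; rewrite addr0 => ->.
by rewrite -(subrr a) star_homB subrr addr0.
Qed.

Lemma star_hom_eigenvalue (b : C0 R X l) (e : Cplx R) :
  (forall x i j, `|b x i j| <= e) -> l%:R * e < 1 ->
  forall a, eigenvalue (g b) a -> `|a| <= 1.
Proof.
move=> be le1 a /eigenvalueP[v Ev v0].
rewrite real_leNgt ?normr_real ?real1 //; apply/negP => /ltW a1.
pose d x := \det (a%:M - b x).
have d0 x : d x != 0 by apply: det_scalar_sub_neq0 a1; [exact: be|exact: le1].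
have csub : continuous (fun x => a%:M - b x).
  by move=> x; apply: cvgB; [exact: cvg_cst|exact: C0_continuous].
pose cf x := (d x)^-1 *: (\adj (a%:M - b x) *m b x).
have ccf : continuous cf.
  move=> x; apply: cvgZ.
    by apply: cvgV => //; exact: (continuous_det csub).
  exact: (continuous_mulmx (continuous_adj csub) (@C0_continuous _ _ _ b)).
have cf0 : cf point = 0 by rewrite /cf C0_point mulmx0 scaler0.
pose c := mkC0 ccf cf0.
have Ec : b = a *: c - C0_mul b c.
  apply: C0P => x; transitivity ((a%:M - b x) *m cf x).
    rewrite /cf -scalemxAr mulmxA mul_mx_adj mul_scalar_mx scalerA.
    by rewrite mulVf ?scale1r.
  by rewrite mulmxBl mul_scalar_mx.
have : v *m g b = 0.
  rewrite Ec star_homB star_homZ; have [_ -> _] := gP.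
  by rewrite mulmxBr -scalemxAr mulmxA Ev -scalemxAl subrr.
move/eqP; rewrite Ev scaler_eq0 (negbTE v0) orbF => /eqP a0.
by rewrite a0 normr0 ler10 in a1.
Qed.

Lemma mxtrace_adjmx_mul (A : 'M[Cplx R]_k) :
  \tr (adjmx A *m A) = \sum_j \sum_i `|A i j| ^+ 2.
Proof.
apply: eq_bigr => j _; rewrite mxE; apply: eq_bigr => i _.
by rewrite !mxE normCK mulrC.
Qed.

Lemma star_hom_bounded (b : C0 R X l) :
  (forall x i j, `|b x i j| <= l.+1%:R^-1) ->
  forall i j, `|g b i j| <= k.+1%:R.
Proof.
move=> hb i j; set e : Cplx R := _^-1 in hb.
have e0 : 0 <= e by rewrite invr_ge0 ler0n.
have le1 : l%:R * e < 1 by rewrite ltr_pdivrMr ?ltr0n // mul1r ltr_nat.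
have hbb x p q : `|C0_mul (C0_star b) b x p q| <= l%:R * (e * e).
  rewrite mxE; apply: le_trans (ler_norm_sum _ _ _) _.
  apply: (@le_trans _ _ (\sum_(r < l) (e * e))).
    apply: ler_sum => r _; rewrite normrM !mxE norm_conjC.
    by apply: ler_pM.
  by rewrite sumr_const card_ord mulr_natl.
have lle1 : l%:R * (l%:R * (e * e)) < 1.
  by rewrite mulrA -mulrACA mulr_ilt1 // mulr_ge0 // ler0n.
have := norm_mxtrace_le (star_hom_eigenvalue hbb lle1).
have [_ -> ->] := gP; rewrite mxtrace_adjmx_mul => tr_le.
have Sge0 : 0 <= \sum_j \sum_i `|g b i j| ^+ 2.
  by apply: sumr_ge0 => p _; apply: sumr_ge0 => q _; rewrite exprn_ge0.
rewrite ger0_norm // in tr_le.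
have : `|g b i j| ^+ 2 <= k%:R.
  apply: le_trans tr_le; rewrite (bigD1 j) //= (bigD1 i) //= -addrA lerDl.
  apply: addr_ge0; first by apply: sumr_ge0 => q _; rewrite exprn_ge0.
  by apply: sumr_ge0 => p _; apply: sumr_ge0 => q _; rewrite exprn_ge0.
move=> sq_le; rewrite -(@ler_pXn2r _ 2) // ?nnegrE ?ler0n //.
apply: le_trans sq_le _.
by rewrite -natrX ler_nat (leq_trans (leqnSn k)) // -{1}[k.+1]expn1 leq_pexp2l.
Qed.

Lemma star_hom_cts0 (eps : Cplx R) : 0 < eps ->
  exists2 delta : Cplx R, 0 < delta &
    forall b : C0 R X l, (forall x i j, `|b x i j| <= delta) ->
      forall i j, `|g b i j| < eps.
Proof.
move=> eps0; pose c : Cplx R := eps / k.+2%:R.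
have c0 : 0 < c by rewrite divr_gt0 // ltr0n.
exists (c * l.+1%:R^-1) => [|b hb i j].
  by rewrite mulr_gt0 // invr_gt0 ltr0n.
have : `|g (c^-1 *: b) i j| <= k.+1%:R.
  apply: star_hom_bounded => x p q.
  have -> : (c^-1 *: b) x p q = c^-1 * b x p q.
    by transitivity ((c^-1 *: b x) p q) => //; rewrite mxE.
  by rewrite normrM gtr0_norm ?invr_gt0 // ler_pdivrMl.
rewrite star_homZ mxE normrM gtr0_norm ?invr_gt0 // ler_pdivrMl // => le_c.
apply: le_lt_trans le_c _; rewrite /c -mulrA gtr_pMr //.
by rewrite ltr_pdivrMl ?ltr0n // mulr1 ltr_nat.
Qed.

End AutomaticContinuity.

Section FiniteCW.
Variable R : realType.

(* Disks are Euclidean, while the norm of 'rV[R]_n in the library is the maximum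
   norm. *)
Definition sqnorm n (v : 'rV[R]_n) : R := \sum_i v 0 i ^+ 2.
Definition cdisk n := [set v : 'rV[R]_n | sqnorm v <= 1].
Definition odisk n := [set v : 'rV[R]_n | sqnorm v < 1].
Definition sphere n := [set v : 'rV[R]_n | sqnorm v = 1].

(* A CW structure with finitely many cells, given by characteristic maps: X is
   Hausdorff and is the disjoint union of the open cells, on each of which the
   characteristic map is injective, and the boundary of a cell lies in cells of
   smaller dimension. As there are finitely many cells, the weak topology is
   automatic, and so is the fact that a characteristic map is a homeomorphism
   from the open disk onto its open cell. The base point is a 0-cell. *)
Record cw_structure (X : ptopologicalType) := CWStructure {
  cw_hausdorff : hausdorff_space X;
  cw_cell : finType;
  cw_dim : cw_cell -> nat;
  cw_char : forall i, 'rV[R]_(cw_dim i) -> X;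
  cw_char_continuous : forall i,
    {within @cdisk (cw_dim i), continuous (cw_char (i := i))};
  cw_partition : forall x, exists! p : {i : cw_cell & 'rV[R]_(cw_dim i)},
    odisk (tagged p) /\ cw_char (tagged p) = x;
  cw_boundary : forall i (v : 'rV[R]_(cw_dim i)), sphere v ->
    exists j (w : 'rV[R]_(cw_dim j)),
      [/\ (cw_dim j < cw_dim i)%N, odisk w & cw_char w = cw_char v];
  cw_point : exists i (v : 'rV[R]_(cw_dim i)),
    cw_dim i = 0%N /\ cw_char v = point
}.

Record finCW := FinCW {
  finCW_space :> ptopologicalType;
  finCW_cells : cw_structure finCW_space
}.

Lemma compact_cdisk n : compact (@cdisk n).
Proof.
apply: bounded_closed_compact.
  exists 1; split; first exact: real1.
  move=> M M1 v /= v1; rewrite /Num.Def.normr /= mx_normrE.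
  apply: bigmax_le => [|[i j] _] /=; first by rewrite (le_trans ler01) // ltW.
  rewrite (ord1 i); apply: le_trans (ltW M1).
  rewrite -[leLHS]ger0_norm ?normr_ge0 // normr_id -(@expr_le1 _ 2) //.
  rewrite real_normK ?num_real //; apply: le_trans v1.
  by rewrite /sqnorm (bigD1 j) //= lerDl sumr_ge0 // => q _; rewrite sqr_ge0.
have csq : continuous (@sqnorm n).
  apply: continuous_sumr => j _ v; rewrite /=.
  apply: (@cvg_comp _ _ _ (fun w : 'rV[R]_n => w 0 j) (fun a => a ^+ 2)).
    exact: coord_continuous.
  exact: exprn_continuous.
rewrite (_ : cdisk (n:=n) = @sqnorm n @^-1` [set a | a <= 1]) //.
by move/continuous_closedP : csq; apply; exact: closed_le.
Qed.

Lemma compact_finCW (X : finCW) : compact [set: X].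
Proof.
case: X => X S /=.
have -> : [set: X] = \big[setU/set0]_(i : cw_cell S)
    (cw_char (i := i) @` cdisk (n:=cw_dim i)).
  apply/seteqP; split=> // x _; have [[i v] [[/= v1 <-] _]] := cw_partition S x.
  by rewrite (bigD1 i) //=; left; exists v => //; exact: ltW.
apply: bigsetU_compact => i _; apply: continuous_compact.
  exact: cw_char_continuous.
exact: compact_cdisk.
Qed.

End FiniteCW.

Record pointed_map (X Y : ptopologicalType) :=
  PointedMap {
  pointed_map_fun :> X -> Y;
  pointed_map_continuous : continuous pointed_map_fun;
  pointed_map_point : pointed_map_fun point = point
}.

(* The smash product: the product with the two axes collapsed to a point, with
   the quotient topology. *)
Section Smash.
Variables X Y : ptopologicalType.

Definition in_wedge (p : X * Y) := (p.1 == point) || (p.2 == point).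

Definition smash_rel : rel (X * Y) :=
  fun p q => (p == q) || in_wedge p && in_wedge q.

Lemma smash_rel_refl : reflexive smash_rel.
Proof. by move=> p; rewrite /smash_rel eqxx. Qed.

Lemma smash_rel_sym : symmetric smash_rel.
Proof. by move=> p q; rewrite /smash_rel eq_sym andbC. Qed.

Lemma smash_rel_trans : transitive smash_rel.
Proof.
move=> q p r /orP[/eqP->//|/andP[wp wq]] /orP[/eqP<-|/andP[_ wr]];
by rewrite /smash_rel ?wp ?wq ?wr orbT.
Qed.

Canonical smash_equiv :=
  EquivRel smash_rel smash_rel_refl smash_rel_sym smash_rel_trans.

Definition smash := {eq_quot smash_equiv}.
HB.instance Definition _ := Topological.copy smash (quotient_topology smash).
HB.instance Definition _ := EqQuotient.on smash.
HB.instance Definition _ :=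
  isPointed.Build smash (\pi_smash (point, point)).

Definition smash_pair (p : X * Y) : smash := \pi_smash p.

Lemma smash_pair_wedge p : in_wedge p -> smash_pair p = point.
Proof.
by move=> wp; apply/eqmodP; rewrite /= /smash_rel wp /in_wedge /= eqxx orbT.
Qed.

Lemma smash_pair_continuous : continuous smash_pair.
Proof. exact: pi_continuous. Qed.

Section Lift.
Variables (Z : Type) (z0 : Z) (h : X * Y -> Z).
Hypothesis hw : forall p, in_wedge p -> h p = z0.

Definition smash_lift : smash -> Z := fun u => h (repr u).

Lemma smash_liftE p : smash_lift (smash_pair p) = h p.
Proof.
rewrite /smash_lift /smash_pair; case: piP => q /eqmodP.
by case/orP => [/eqP->//|/andP[/hw-> /hw->]].
Qed.
End Lift.

Lemma smash_lift_continuous (Z : topologicalType) (h : X * Y -> Z) z0 :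
  (forall p, in_wedge p -> h p = z0) -> continuous h ->
  continuous (smash_lift h : smash -> Z).
Proof.
move=> hw ch; apply/(@quotient_continuous _ smash).
rewrite (_ : _ \o _ = h) //; apply/funext => p; exact: (smash_liftE hw).
Qed.

Lemma smash_ind (P : smash -> Prop) :
  (forall p, P (smash_pair p)) -> forall u, P u.
Proof. by move=> h u; rewrite -[u]reprK; exact: h. Qed.

End Smash.
Arguments smash_pair {X Y}.

Section SmashMap.
Variables (X Y X' Y' : ptopologicalType) (f : pointed_map X X')
  (g : pointed_map Y Y').

Definition smash_map_pair (p : X * Y) : smash X' Y' :=
  smash_pair (f p.1, g p.2).

Lemma smash_map_pair_wedge p : in_wedge p -> smash_map_pair p = point.
Proof.
move=> wp; apply: smash_pair_wedge; case/orP: wp => /eqP E;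
  by rewrite /in_wedge /= E pointed_map_point eqxx ?orbT.
Qed.

Lemma smash_map_pair_continuous : continuous smash_map_pair.
Proof.
move=> p; apply: (@continuous_comp _ _ _ (fun p => (f p.1, g p.2)) smash_pair).
  apply: cvg_pair => /=.
    apply: (@continuous_comp _ _ _ fst f); first exact: cvg_fst.
    exact: pointed_map_continuous.
  apply: (@continuous_comp _ _ _ snd g); first exact: cvg_snd.
  exact: pointed_map_continuous.
exact: smash_pair_continuous.
Qed.

Lemma smash_map_point : smash_lift smash_map_pair (point : smash X Y) = point.
Proof.
rewrite [LHS](smash_liftE smash_map_pair_wedge (point, point)).
by apply: smash_map_pair_wedge; rewrite /in_wedge eqxx.
Qed.

Definition smash_map : pointed_map (smash X Y) (smash X' Y') :=
  PointedMap
    (smash_lift_continuous smash_map_pair_wedge smash_map_pair_continuous)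
    smash_map_point.

Lemma smash_mapE p : smash_map (smash_pair p) = smash_pair (f p.1, g p.2).
Proof. exact: smash_liftE smash_map_pair_wedge p. Qed.

End SmashMap.

Section LinearSpan.
Variables (K : fieldType) (V : vectType K).

Lemma exists_span (S : set V) : exists U : {vspace V},
  (forall v, S v -> v \in U) /\
  (forall W : {vspace V}, (forall v, S v -> v \in W) -> (U <= W)%VS).
Proof.
pose P d :=
  `[< exists2 s : seq V, (forall v, v \in s -> S v) & \dim (span s) = d >].
have exP : exists d, P d.
  by exists 0%N; apply/asboolP; exists [::] => //; rewrite span_nil dimv0.
have ubP d : P d -> (d <= \dim {:V})%N.
  by move=> /asboolP[s _ <-]; rewrite dimvS ?subvf.
have [d /asboolP[s sS ds] dmax] := ex_maxnP exP ubP.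
exists (span s); split=> [v Sv|W SW]; last by apply/span_subvP => v /sS/SW.
have /dmax : P (\dim (span (v :: s))).
  by apply/asboolP; exists (v :: s) => // w; rewrite inE => /predU1P[->|/sS].
rewrite -ds => dle; have sub : (span s <= span (v :: s))%VS.
  by rewrite span_cons addvSr.
have /eqP -> : span s == span (v :: s) by rewrite eqEdim sub.
by rewrite memv_span ?mem_head.
Qed.

(* The library's [span] is for finite sequences; this is the linear span of an
   arbitrary subset of a finite-dimensional space. *)
Definition lin_span (S : set V) : {vspace V} := projT1 (cid (exists_span S)).

Lemma mem_lin_span S v : S v -> v \in lin_span S.
Proof. by rewrite /lin_span; case: cid => U /= [h _]; exact: h. Qed.

Lemma lin_span_sub S (W : {vspace V}) :
  (forall v, S v -> v \in W) -> (lin_span S <= W)%VS.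
Proof. by rewrite /lin_span; case: cid => U /= [_ h]; exact: h. Qed.

Lemma lin_spanS S S' : S `<=` S' -> (lin_span S <= lin_span S')%VS.
Proof. by move=> SS'; apply: lin_span_sub => v /SS'; exact: mem_lin_span. Qed.
End LinearSpan.

Section GSpace.
Variables (R : realType) (k l : nat).

Section Pullback.
Variables (X Y : ptopologicalType) (f : pointed_map X Y).

Lemma C0_pull_continuous (a : C0 R Y l) : continuous (a \o f).
Proof.
by move=> x; apply: continuous_comp;
  [exact: pointed_map_continuous|exact: C0_continuous].
Qed.

Lemma C0_pull_point (a : C0 R Y l) : (a \o f) point = 0.
Proof. by rewrite /= pointed_map_point C0_point. Qed.

Definition C0_pull (a : C0 R Y l) : C0 R X l :=
  mkC0 (@C0_pull_continuous a) (C0_pull_point a).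
End Pullback.

(* G_{k,l}(X), with the topology of pointwise convergence. The definition makes
   sense for every pointed space X. *)
Definition G (X : ptopologicalType) : Type :=
  set_type [set F : {ptws C0 R X l -> 'M[Cplx R]_k} | star_hom F].

Section GInstances.
Variable X : ptopologicalType.
HB.instance Definition _ := Topological.on (G X).

Definition mkG (F : C0 R X l -> 'M[Cplx R]_k) (hF : star_hom F) : G X :=
  SigSub (mem_set hF :
    F \in [set F : {ptws C0 R X l -> 'M[Cplx R]_k} | star_hom F]).

Definition G_fun (f : G X) : C0 R X l -> 'M[Cplx R]_k := val f.

Lemma G_star_hom (f : G X) : star_hom (G_fun f).
Proof. exact: (set_mem (valP f)). Qed.

Lemma G_eq (f g : G X) : G_fun f =1 G_fun g -> f = g.
Proof. by move=> fg; apply/val_inj/funext. Qed.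

Lemma zero_star_hom : star_hom (fun _ : C0 R X l => 0 : 'M[Cplx R]_k).
Proof.
split=> [c a b|a b|a]; rewrite ?scaler0 ?addr0 ?mul0mx //.
by rewrite /adjmx trmx0 map_mx0.
Qed.

HB.instance Definition _ := isPointed.Build (G X) (mkG zero_star_hom).

Lemma G_eval_continuous a : continuous (fun f : G X => G_fun f a).
Proof.
move=> f.
apply: (@continuous_comp (G X) {ptws C0 R X l -> 'M[Cplx R]_k} _
  (@G_fun) (fun F => F a)).
  exact: initial_continuous.
exact: proj_continuous.
Qed.

Lemma G_continuous (T : topologicalType) (h : T -> G X) :
  (forall a, continuous (fun t => G_fun (h t) a)) -> continuous h.
Proof.
move=> ch.
have cvh : continuous
    ((fun t => G_fun (h t)) : T -> {ptws C0 R X l -> 'M[Cplx R]_k}).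
  move=> t; apply/cvg_sup => a U [_ [[W oW <-] Wt WU]].
  apply: (filterS WU); apply: (ch a t).
  by apply: open_nbhs_nbhs; split.
apply/continuousP => _ [B oB <-].
by move/continuousP : cvh => /(_ _ oB).
Qed.

Definition G_image (f : G X) : set 'M[Cplx R]_k := range (G_fun f).

Definition G_space (f : G X) : {vspace 'cV[Cplx R]_k} :=
  lin_span [set A *m v | A in G_image f & v in [set: 'cV[Cplx R]_k]].

(* The dimension of [G_space f] = A_f . C^k is a multiple of l, so the quotient
   is exact. *)
Definition G_rank (f : G X) : nat := (\dim (G_space f) %/ l)%N.

Lemma G_rank_point : G_rank point = 0%N.
Proof.
rewrite /G_rank; suff -> : G_space point = 0%VS by rewrite dimv0 div0n.
apply/eqP; rewrite -subv0; apply: lin_span_sub => _ [_ [a _ <-] [v _ <-]].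
by rewrite mul0mx mem0v.
Qed.

End GInstances.

(* G_{k,l,r}(X), with the subspace topology. *)
Definition Gr (r : nat) (X : ptopologicalType) : Type :=
  set_type [set f : G X | (G_rank f <= r)%N].

Section GrInstances.
Variables (r : nat) (X : ptopologicalType).
HB.instance Definition _ := Topological.on (Gr r X).

Definition mkGr (f : G X) (hf : (G_rank f <= r)%N) : Gr r X :=
  SigSub (mem_set hf : f \in [set f : G X | (G_rank f <= r)%N]).

Lemma G_rank_point_le : (G_rank (point : G X) <= r)%N.
Proof. by rewrite G_rank_point. Qed.

HB.instance Definition _ := isPointed.Build (Gr r X) (mkGr G_rank_point_le).

Lemma Gr_val_continuous : continuous (val : Gr r X -> G X).
Proof. exact: initial_continuous. Qed.

Definition Gr_incl : pointed_map (Gr r X) (G X) :=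
  PointedMap Gr_val_continuous erefl.

Lemma Gr_rank (f : Gr r X) : (G_rank (Gr_incl f) <= r)%N.
Proof. exact: (set_mem (valP f)). Qed.

Lemma Gr_incl_inj : injective Gr_incl.
Proof. exact: val_inj. Qed.

Lemma Gr_continuous (T : topologicalType) (h : T -> Gr r X) :
  continuous (fun t => Gr_incl (h t)) -> continuous h.
Proof.
by move=> /continuousP ch; apply/continuousP => _ [B oB <-]; exact: ch.
Qed.

End GrInstances.
Arguments Gr_incl {r X}.

Section GMap.
Variables (r : nat) (X Y : ptopologicalType) (u : pointed_map X Y).

Lemma G_map_star_hom (f : G X) :
  star_hom (fun a : C0 R Y l => G_fun f (C0_pull u a)).
Proof.
have [lf mf sf] := G_star_hom f; split=> [c a b|a b|a].
- by rewrite -lf; congr (G_fun f _); exact: C0P.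
- by rewrite -mf; congr (G_fun f _); exact: C0P.
- by rewrite -sf; congr (G_fun f _); exact: C0P.
Qed.

Definition G_map_fun (f : G X) : G Y := mkG (G_map_star_hom f).

Lemma G_map_continuous : continuous G_map_fun.
Proof. by apply: G_continuous => a; exact: G_eval_continuous. Qed.

Lemma G_map_point : G_map_fun point = point.
Proof. exact: G_eq. Qed.

Definition G_map : pointed_map (G X) (G Y) :=
  PointedMap G_map_continuous G_map_point.

Lemma rank_G_map f : (G_rank (G_map f) <= G_rank f)%N.
Proof.
apply/leq_div2r/dimvS/lin_spanS => _ [_ [a _ <-] [v _ <-]].
by exists (G_fun f (C0_pull u a)); [exists (C0_pull u a)|exists v].
Qed.

Lemma rank_Gr_map (f : Gr r X) : (G_rank (G_map (Gr_incl f)) <= r)%N.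
Proof. exact: leq_trans (rank_G_map _) (Gr_rank f). Qed.

Definition Gr_map_fun (f : Gr r X) : Gr r Y := mkGr (rank_Gr_map f).

Lemma Gr_map_continuous : continuous Gr_map_fun.
Proof.
apply: Gr_continuous => f; apply: (@continuous_comp _ _ _ Gr_incl G_map).
  exact: pointed_map_continuous.
exact: pointed_map_continuous.
Qed.

Lemma Gr_map_point : Gr_map_fun point = point.
Proof. by apply: Gr_incl_inj; exact: G_map_point. Qed.

Definition Gr_map : pointed_map (Gr r X) (Gr r Y) :=
  PointedMap Gr_map_continuous Gr_map_point.
End GMap.
End GSpace.
Arguments Gr_incl {R k l r X}.
Arguments G_map {R} k l {X Y} u.
Arguments Gr_map {R} k l r {X Y} u.

Section Composition.
Variables (R : realType) (k l m : nat) (X Y : finCW R).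

Section Slice.
Variable h : C0 R (smash X Y) m.

Lemma C0_slice_continuous x : continuous (fun y => h (smash_pair (x, y))).
Proof.
move=> y.
apply: (@continuous_comp _ _ _ (fun y => smash_pair (x, y)) h).
  apply: (@continuous_comp _ _ _ (fun y => (x, y)) smash_pair).
    by apply: cvg_pair; [exact: cvg_cst|exact: cvg_id].
  exact: smash_pair_continuous.
exact: C0_continuous.
Qed.

Lemma C0_slice_point x : h (smash_pair (x, point)) = 0.
Proof. by rewrite smash_pair_wedge ?C0_point // /in_wedge eqxx orbT. Qed.

(* [C0_slice h] is the image of h under the isomorphism from C_0(X /\ Y, M_m) to
   C_0(X, C_0(Y, M_m)), and [C0_map g h] below is its image under C_0(X, g). *)
Definition C0_slice (x : X) : C0 R Y m :=
  mkC0 (@C0_slice_continuous x) (C0_slice_point x).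

Lemma C0_slice0 : C0_slice point = 0.
Proof.
by apply: C0P => y; rewrite /= smash_pair_wedge ?C0_point // /in_wedge eqxx.
Qed.

Lemma C0_slice_unif (x0 : X) (d : Cplx R) : 0 < d ->
  \forall x \near x0, forall y i j, `|(C0_slice x - C0_slice x0) y i j| <= d.
Proof.
move=> d0.
pose phi i j (p : Y * X) :=
  h (smash_pair (p.2, p.1)) i j - h (smash_pair (x0, p.1)) i j.
have cphi i j : continuous (phi i j).
  have cE (q : Y * X -> X * Y) : continuous q ->
      continuous (fun p => h (smash_pair (q p)) i j).
    move=> cq; apply: continuous_entry => p.
    apply: (@continuous_comp _ _ _ (fun p => smash_pair (q p)) h); last first.
      exact: C0_continuous.
    apply: (@continuous_comp _ _ _ q smash_pair); first exact: cq.
    exact: smash_pair_continuous.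
  move=> p; apply: cvgB.
    by apply: (cE (fun p => (p.2, p.1))) => {}p;
      apply: cvg_pair; [exact: cvg_snd|exact: cvg_fst].
  by apply: (cE (fun p => (x0, p.1))) => {}p;
      apply: cvg_pair; [exact: cvg_cst|exact: cvg_fst].
have ncY : near_covering [set: Y].
  by apply/compact_near_coveringP; exact: compact_finCW.
have near_y : \forall x \near x0, [set: Y] `<=`
    (fun y => forall i j, `|phi i j (y, x)| <= d).
  apply: ncY => y _.
  have cy i j : \forall p \near (y, x0), `|phi i j p| < d.
    have /cvgrPdist_lt/(_ d d0) := cphi i j (y, x0).
    apply: filterS => p /=.
    by rewrite {1}/phi /= subrr sub0r normrN.
  have near_p : \forall p \near (y, x0), forall i j, `|phi i j p| < d.
    apply: (@filter_forall _ _ (fun i p => forall j, `|phi i j p| < d)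
      (nbhs (y, x0)) (nbhs_filter _)) => i.
    exact: (@filter_forall _ _ (fun j p => `|phi i j p| < d)
      (nbhs (y, x0)) (nbhs_filter _) (cy i)).
  by apply: (filterS _ near_p) => -[y' x'] /= H i j; exact/ltW/H.
apply: filterS near_y => x H y i j.
have -> : (C0_slice x - C0_slice x0) y i j = phi i j (y, x); last exact: H.
  by transitivity ((C0_slice x y - C0_slice x0 y) i j) => //; rewrite !mxE.
Qed.
End Slice.

Section C0Map.
Variables (g : G R l m Y) (h : C0 R (smash X Y) m).

Lemma C0_map_continuous : continuous (fun x => G_fun g (C0_slice h x)).
Proof.
move=> x0; apply: mx_cvg => i j; apply/cvgrPdist_lt => e e0.
have [d d0 gd] := star_hom_cts0 (G_star_hom g) e0.
have := C0_slice_unif h x0 d0; apply: filterS => x /gd/(_ i j).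
by rewrite (star_homB (G_star_hom g)) distrC !mxE.
Qed.

Lemma C0_map_point : G_fun g (C0_slice h point) = 0.
Proof.
by rewrite C0_slice0 -(subrr 0) (star_homB (G_star_hom g)) subrr.
Qed.

Definition C0_map : C0 R X l := mkC0 C0_map_continuous C0_map_point.
End C0Map.

Lemma G_comp_star_hom (f : G R k l X) (g : G R l m Y) :
  star_hom (fun h => G_fun f (C0_map g h)).
Proof.
have [lf mf sf] := G_star_hom f; have [lg mg sg] := G_star_hom g.
split=> [c a b|a b|a].
- rewrite -lf; congr (G_fun f _); apply: C0P => x.
  transitivity (c *: G_fun g (C0_slice a x) + G_fun g (C0_slice b x)) => //.
  by rewrite -lg /=; congr (G_fun g _); exact: C0P.
- rewrite -mf; congr (G_fun f _); apply: C0P => x.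
  by rewrite /= -mg; congr (G_fun g _); exact: C0P.
- rewrite -sf; congr (G_fun f _); apply: C0P => x.
  by rewrite /= -sg; congr (G_fun g _); exact: C0P.
Qed.

Definition G_comp (p : G R k l X * G R l m Y) : G R k m (smash X Y) :=
  mkG (G_comp_star_hom p.1 p.2).

Lemma G_comp_wedge p : in_wedge p -> G_comp p = point.
Proof.
case: p => f g /orP[]/= /eqP ->; apply: G_eq => h //.
have [lf _ _] := G_star_hom f.
have -> : G_fun (G_comp (f, point)) h = G_fun f 0.
  by congr (G_fun f _); exact: C0P.
by rewrite -(subrr 0) (star_homB (G_star_hom f)) subrr.
Qed.

Definition G_comp_smash :
    smash (G R k l X) (G R l m Y) -> G R k m (smash X Y) :=
  smash_lift G_comp.

Lemma G_comp_smashE f g : G_comp_smash (smash_pair (f, g)) = G_comp (f, g).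
Proof. exact: smash_liftE G_comp_wedge (f, g). Qed.

End Composition.

(* Main.v *)
Require Import Defs.
From mathcomp Require Import all_boot all_order all_algebra.
From mathcomp Require Import all_classical all_reals all_analysis.

(* The rank bound rests on the following. For a *-homomorphism f from
   C_0(X, M_l) to M_k, the rule B . f(a) v = f(B a) v makes V_f a unital
   M_l-module; it is well defined because A_f is closed under adjoints and the
   Hermitian form is definite. Hence V_f is C^l (x) W, so dim V_f = l dim W, and
   a matrix P of rank d satisfies dim (P . V_f) <= d dim W. If P projects C^l
   onto V_g then C_0(X, g) takes values in P C_0(X, M_l), so V_(f o g) lies in
   P . V_f and dim V_(f o g) <= dim V_g dim W = m rank(g) rank(f).

   Composition is jointly continuous since *-homomorphisms are equicontinuous
   and X is compact: if g' tends to g pointwise then C_0(X, g') h tends to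
   C_0(X, g) h uniformly on X. *)

Set Implicit Arguments.
Unset Strict Implicit.
Unset Printing Implicit Defensive.
Import Order.TTheory GRing.Theory Num.Theory numFieldNormedType.Exports.
Local Open Scope classical_set_scope.
Local Open Scope ring_scope.

(** * Modules over a full matrix algebra *)

Section MatrixModule.
Variables (K : fieldType) (U : vectType K) (l : nat).
Variables (T : 'M[K]_l.+1 -> 'End(U)) (V : {vspace U}).
Hypothesis TV : forall A v, v \in V -> T A v \in V.
Hypothesis T1 : forall v, v \in V -> T 1%:M v = v.
Hypothesis TM : forall A B v, v \in V -> T (A *m B) v = T A (T B v).
Hypothesis Tsum : forall I (s : seq I) (A : I -> 'M[K]_l.+1) v,
  T (\sum_(i <- s) A i) v = \sum_(i <- s) T (A i) v.

Let e (i : 'I_l.+1) : 'cV[K]_l.+1 := delta_mx i 0.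
Let W := (T (delta_mx 0 0) @: V)%VS.

(** With E_00 = [delta_mx 0 0], each [L i *m M i] factors as [B i] E_00 (e_0 [M i]). The last factor
    preserves [V], so the image lies in the sum of the spaces [T (B i) @: W]. *)
Lemma dim_rank1_image d (L : 'I_d -> 'cV[K]_l.+1) (M : 'I_d -> 'rV[K]_l.+1) :
  (\dim (T (\sum_i L i *m M i) @: V) <= d * \dim W)%N.
Proof.
pose B i := L i *m (e 0)^T.
apply: (@leq_trans (\dim (\sum_i T (B i) @: W)%VS)).
  apply/dimvS/subvP => _ /memv_imgP[v vV ->]; rewrite Tsum.
  apply: memv_sumr => i _.
  have -> : L i *m M i = B i *m (delta_mx 0 0 *m (e 0 *m M i)).
    rewrite /B /e trmx_delta -!mulmxA; congr (_ *m _).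
    rewrite [in RHS](mulmxA _ (delta_mx 0 0) (_ *m _)) mul_delta_mx mulmxA.
    rewrite mul_delta_mx; apply/rowP => j.
    by rewrite [RHS]mxE big_ord1 mxE eqxx mul1r.
  by rewrite TM // TM //; do 2 apply: memv_img; exact: TV.
apply: leq_trans (dimv_leq_sum _ _ _) _.
rewrite -[in leqRHS](card_ord d) -sum_nat_const; apply: leq_sum => i _.
by rewrite -(limg_ker_dim (T (B i)) W) leq_addl.
Qed.

(** [W] is the multiplicity space. Upper bound: 1 is the sum of the [l.+1] rank-one matrices e_i
    e_i^T. Lower bound: the images of the orthogonal idempotents E_ii are independent in [V], and
    none is smaller than [W] because E_00 = E_0i E_ii E_i0. *)
Lemma dim_matrix_module : \dim V = (l.+1 * \dim W)%N.
Proof.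
apply/eqP; rewrite eqn_leq; apply/andP; split.
  have <- : (T 1%:M @: V)%VS = V.
    apply/vspaceP => v; apply/memv_imgP/idP => [[u uV ->]|vV]; first exact: TV.
    by exists v => //; rewrite T1.
  have -> : 1%:M = \sum_i e i *m (e i)^T :> 'M[K]_l.+1.
    rewrite [LHS]matrix_sum_delta; apply: eq_bigr => i _.
    rewrite (bigD1 i) //= big1 ?addr0 => [|j ji].
      by rewrite mxE eqxx scale1r trmx_delta mul_delta_mx.
    by rewrite mxE eq_sym (negbTE ji) scale0r.
  exact: dim_rank1_image.
pose Wi i := (T (delta_mx i i) @: V)%VS.
have dimWi i : (\dim W <= \dim (Wi i))%N.
  have sub : (W <= T (delta_mx 0 i) @: Wi i)%VS.
    apply/subvP => _ /memv_imgP[v vV ->].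
    rewrite -(mul_delta_mx i 0) -[delta_mx i 0](mul_delta_mx i).
    by rewrite TM // TM //; do 2 apply: memv_img; exact: TV.
  apply: leq_trans (dimvS sub) _.
  by rewrite -(limg_ker_dim (T (delta_mx 0 i)) (Wi i)) leq_addl.
have WiV i : (Wi i <= V)%VS.
  by apply/subvP => _ /memv_imgP[v vV ->]; exact: TV.
have fixWi i v : v \in Wi i -> T (delta_mx i i) v = v.
  by move=> /memv_imgP[u uV ->]; rewrite -TM // mul_delta_mx.
have T0 v : T 0 v = 0.
  by have := Tsum (nil : seq nat) (fun=> 0) v; rewrite !big_nil.
have killWi i j v : i != j -> v \in Wi j -> T (delta_mx i i) v = 0.
  by move=> ij /memv_imgP[u uV ->]; rewrite -TM // mul_delta_mx_0 // T0.
have dW : directv (\sum_i Wi i)%VS.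
  apply/directv_sumP => i _; apply/eqP; rewrite -subv0; apply/subvP => v.
  rewrite memv_cap memv0 => /andP[vi /memv_sumP[u uj vE]].
  rewrite -(fixWi _ _ vi) vE linear_sum /= big1 // => j ji.
  by rewrite (killWi _ j) ?uj // eq_sym.
apply: (@leq_trans (\dim (\sum_i Wi i)%VS)); last first.
  by apply/dimvS/subv_sumP => i _; exact: WiV.
rewrite (directvP dW) /= -[in leqLHS](card_ord l.+1) -sum_nat_const.
exact: leq_sum.
Qed.

End MatrixModule.

(** * Conjugate transposes and definiteness *)

Section Adjoint.
Variable K : numClosedFieldType.

Lemma adjmxM m n p (A : 'M[K]_(m, n)) (B : 'M[K]_(n, p)) :
  adjmx (A *m B) = adjmx B *m adjmx A.
Proof. by rewrite /adjmx trmx_mul map_mxM. Qed.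

Lemma adjmxB m n (A B : 'M[K]_(m, n)) : adjmx (A - B) = adjmx A - adjmx B.
Proof. by rewrite /adjmx linearB /= map_mxB. Qed.

Lemma adjmx0 m n : adjmx (0 : 'M[K]_(m, n)) = 0.
Proof. by rewrite /adjmx trmx0 map_mx0. Qed.

Lemma adjmxK m n : cancel (@adjmx K m n) (@adjmx K n m).
Proof. by move=> A; apply/matrixP => i j; rewrite !mxE conjCK. Qed.

Lemma mulmx_adjmx_diag m n (A : 'M[K]_(m, n)) i :
  (A *m adjmx A) i i = \sum_j `|A i j| ^+ 2.
Proof. by rewrite mxE; apply: eq_bigr => j _; rewrite !mxE normCK. Qed.

(** The diagonal entries of the sum are sums of squared moduli, and every entry of every [A i]
    occurs in one of them. *)
Lemma sum_mulmx_adjmx_eq0 (I : eqType) (s : seq I) m n (A : I -> 'M[K]_(m, n)) :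
  \sum_(i <- s) A i *m adjmx (A i) = 0 -> forall i, i \in s -> A i = 0.
Proof.
move=> S0 i si; apply/matrixP => p q; rewrite [RHS]mxE.
have /(congr1 (fun M : 'M[K]_m => M p p)) := S0.
rewrite summxE [RHS]mxE; under eq_bigr do rewrite mulmx_adjmx_diag.
have ge0 j : true -> 0 <= \sum_q `|A j p q| ^+ 2.
  by move=> _; apply: sumr_ge0 => r _; rewrite exprn_ge0.
move/eqP; rewrite psumr_eq0 // => /allP/(_ i si)/eqP/psumr_eq0P h.
by have /eqP := h (fun r _ => exprn_ge0 2 (normr_ge0 _)) q isT;
  rewrite sqrf_eq0 normr_eq0 => /eqP.
Qed.

Lemma adjmx_mulmx_eq0 m n (A : 'M[K]_(m, n)) : adjmx A *m A = 0 -> A = 0.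
Proof.
move=> A0; rewrite -[A]adjmxK.
have : adjmx A = 0; last by move=> ->; rewrite adjmx0.
apply: (@sum_mulmx_adjmx_eq0 _ [:: tt] _ _ (fun=> adjmx A) _ tt) => //.
by rewrite big_seq1 adjmxK.
Qed.
End Adjoint.

(** * Star homomorphisms into matrices and the action on V_F *)

Section StarHom.
Variables (R : realType) (X : ptopologicalType) (l k : nat).
Implicit Types (a b c : C0 R X l) (B : 'M[Cplx R]_l).

Lemma C0_lmul_continuous B a : continuous (fun x => B *m a x).
Proof.
by apply: continuous_mulmx => [x|]; [exact: cvg_cst|exact: C0_continuous].
Qed.

Lemma C0_lmul_point B a : B *m a point = 0.
Proof. by rewrite C0_point mulmx0. Qed.

Definition C0_lmul B a : C0 R X l :=
  mkC0 (@C0_lmul_continuous B a) (C0_lmul_point B a).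

Variable F : C0 R X l -> 'M[Cplx R]_k.
Hypothesis FP : star_hom F.

Lemma star_hom0 : F 0 = 0.
Proof. by rewrite -(subrr 0) (star_homB FP) subrr. Qed.

Lemma star_homD a b : F (a + b) = F a + F b.
Proof. by have [lF _ _] := FP; rewrite -[a]scale1r lF !scale1r. Qed.

Lemma star_homM a b : F (C0_mul a b) = F a *m F b.
Proof. by have [_ ->] := FP. Qed.

Lemma star_hom_adj a : F (C0_star a) = adjmx (F a).
Proof. by have [_ _ ->] := FP. Qed.

(** Rescaling reduces this to [star_hom_bounded]. The bound does not depend on [F]; equicontinuity
    comes from that. *)
Lemma star_hom_norm_le (d : Cplx R) b : 0 < d ->
  (forall x i j, `|b x i j| <= d) ->
  forall i j, `|F b i j| <= k.+1%:R * (l.+1%:R * d).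
Proof.
move=> d0 bd i j; set c := l.+1%:R * d.
have c0 : 0 < c by rewrite mulr_gt0 ?ltr0n.
have : `|F (c^-1 *: b) i j| <= k.+1%:R.
  apply: star_hom_bounded => // x p q.
  have -> : (c^-1 *: b) x p q = c^-1 * b x p q.
    by transitivity ((c^-1 *: b x) p q) => //; rewrite mxE.
  rewrite normrM gtr0_norm ?invr_gt0 // /c invfM -mulrA.
  rewrite ger_pMr ?invr_gt0 ?ltr0n //.
  by rewrite ler_pdivrMl // mulr1.
rewrite (star_homZ FP) mxE normrM gtr0_norm ?invr_gt0 // ler_pdivrMl //.
by rewrite mulrC.
Qed.

Definition sumsq (s : seq (C0 R X l)) : C0 R X l :=
  \sum_(a <- s) C0_mul a (C0_star a).

Lemma star_hom_sumsq s : F (sumsq s) = \sum_(a <- s) F a *m adjmx (F a).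
Proof.
rewrite /sumsq (big_morph F star_homD star_hom0).
by apply: eq_bigr => a _; rewrite star_homM star_hom_adj.
Qed.

(** Multiplying by x^* on the right gives the sum of the (x F(a)) (x F(a))^*, and definiteness
    applies. *)
Lemma sumsq_ker n (x : 'M[Cplx R]_(n, k)) s :
  x *m F (sumsq s) = 0 -> forall a, a \in s -> x *m F a = 0.
Proof.
move=> x0 a sa; apply: (sum_mulmx_adjmx_eq0 (A := fun a => x *m F a)) sa.
transitivity (x *m F (sumsq s) *m adjmx x); last by rewrite x0 mul0mx.
rewrite star_hom_sumsq mulmx_sumr mulmx_suml; apply: eq_bigr => c _.
by rewrite adjmxM !mulmxA.
Qed.

Lemma ker_sumsq n (x : 'M[Cplx R]_(n, k)) s :
  (forall a, a \in s -> x *m F a = 0) -> x *m F (sumsq s) = 0.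
Proof.
move=> xs; rewrite star_hom_sumsq mulmx_sumr big_seq big1 // => a /xs xa.
by rewrite mulmxA xa mul0mx.
Qed.

(* b stands in for a unit: the column space of F b is all of V_F. It is a sum of
   squares a a^* for which the rank of F b is maximal. *)
Lemma exists_full_sumsq :
  exists b, forall n (x : 'M[Cplx R]_(n, k)),
    x *m F b = 0 -> forall a, x *m F a = 0.
Proof.
pose P d := `[< exists s, \rank (F (sumsq s)) = d >].
have exP : exists d, P d.
  by exists (\rank (F (sumsq [::]))); apply/asboolP; exists [::].
have ubP d : P d -> (d <= k)%N by move=> /asboolP[s <-]; exact: rank_leq_row.
have [d /asboolP[s rs] dmax] := ex_maxnP exP ubP.
exists (sumsq s) => n x x0 a.
have le_r : (\rank (F (sumsq (a :: s))) <= \rank (F (sumsq s)))%N.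
  by rewrite rs; apply: dmax; apply/asboolP; exists (a :: s).
(* A longer list has a smaller left kernel; maximality of the rank makes the two kernels equal. *)
have sub : (kermx (F (sumsq (a :: s))) <= kermx (F (sumsq s)))%MS.
  apply/sub_kermxP/ker_sumsq => c sc.
  by apply: (sumsq_ker (mulmx_ker _)); rewrite inE sc orbT.
have sub' : (kermx (F (sumsq s)) <= kermx (F (sumsq (a :: s))))%MS.
  by rewrite -(geq_leqif (mxrank_leqif_sup sub)) !mxrank_ker leq_sub2l.
have /sub_kermxP xs : (x <= kermx (F (sumsq (a :: s))))%MS.
  by apply: submx_trans sub'; apply/sub_kermxP.
exact: sumsq_ker xs _ (mem_head _ _).
Qed.

(** This makes the action of [B] well defined. Every [F c] kills the difference [Z], as [B] can be
    moved onto [c]; then Z^* Z = 0, since Z^* is a combination of terms ending in some [F c]. *)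
Lemma lmul_relation n (Y : 'M[Cplx R]_(k, n)) (Y' : 'M[Cplx R]_(k, n)) B b a :
  F b *m Y = F a *m Y' -> F (C0_lmul B b) *m Y = F (C0_lmul B a) *m Y'.
Proof.
move=> E; apply/eqP; rewrite -subr_eq0; apply/eqP; set Z := _ - _.
have FZ c : F c *m Z = 0.
  have EB d : F c *m F (C0_lmul B d) =
      F (C0_star (C0_lmul (adjmx B) (C0_star c))) *m F d.
    rewrite -!star_homM; congr (F _); apply: C0P => x /=.
    by rewrite adjmxM !adjmxK mulmxA.
  by rewrite mulmxBr !mulmxA !EB -!mulmxA E subrr.
apply: adjmx_mulmx_eq0.
rewrite {1}/Z adjmxB !adjmxM -!star_hom_adj mulmxBl -!mulmxA !FZ.
by rewrite !mulmx0 subrr.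
Qed.

(* T B is the action of B on V_F. *)
Lemma exists_lmul : exists T : 'M[Cplx R]_l -> 'M[Cplx R]_k,
  (forall B a, T B *m F a = F (C0_lmul B a)) /\
  (forall I (s : seq I) A, T (\sum_(i <- s) A i) = \sum_(i <- s) T (A i)).
Proof.
have [b bfull] := exists_full_sumsq.
(* [T B] has to send [F b] to [F (C0_lmul B b)], which determines it on V_F; the pseudo-inverse
   selects one such matrix, additively in [B]. *)
exists (fun B => F (C0_lmul B b) *m pinvmx (F b)); split=> [B a|I s A].
  have sub : (F (C0_lmul B b) <= F b)%MS.
    rewrite submxE -(mulmx0 _ (F (C0_lmul B b))); apply/eqP.
    by apply: lmul_relation; rewrite mulmx0 mulmx_coker.
  (* Fullness of [b], transposed: the columns of [F a] lie in the column space of [F b]. *)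
  have [Y EY] : exists Y, F a = F b *m Y.
    have : ((F a)^T <= (F b)^T)%MS.
      rewrite submxE; apply/eqP/trmx_inj; rewrite trmx_mul trmxK trmx0.
      by apply/bfull/trmx_inj; rewrite trmx_mul trmxK mulmx_coker trmx0.
    move=> /submxP[Z EZ]; exists Z^T; apply/trmx_inj.
    by rewrite EZ trmx_mul trmxK.
  rewrite EY mulmxA mulmxKpV // -[RHS]mulmx1; apply: lmul_relation.
  by rewrite mulmx1 EY.
have -> : C0_lmul (\sum_(i <- s) A i) b = \sum_(i <- s) C0_lmul (A i) b.
  apply: (big_morph (fun B => C0_lmul B b)) => [B C|]; apply: C0P => x /=.
    by rewrite mulmxDl.
  by rewrite mul0mx.
by rewrite (big_morph F star_homD star_hom0) mulmx_suml.
Qed.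

End StarHom.

(** * The rank of a composite *)

(** [w] is the dimension of the multiplicity space of V_f. The span in the second clause is P . V_f,
    for P given as a sum of [d] rank-one matrices. *)
Lemma dim_G_space (R : realType) (k l : nat) (X : ptopologicalType)
    (f : G R k l.+1 X) : exists w, \dim (G_space f) = (l.+1 * w)%N /\
  forall d (L : 'I_d -> 'cV_l.+1) (M : 'I_d -> 'rV_l.+1),
    (\dim (lin_span [set G_fun f (C0_lmul (\sum_i L i *m M i) a) *m v
       | a in [set: C0 R X l.+1] & v in [set: 'cV[Cplx R]_k]]) <= d * w)%N.
Proof.
have [T [TE Tsum]] := exists_lmul (G_star_hom f).
set F := G_fun f in TE *; set V := G_space f.
pose t B : 'End('cV[Cplx R]_k) := linfun (mulmx (T B)).
have tE B v : t B v = T B *m v by rewrite lfunE.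
have VF a v : F a *m v \in V.
  by apply: mem_lin_span; exists (F a); [exists a|exists v].
have tF B a v : t B (F a *m v) = F (C0_lmul B a) *m v.
  by rewrite tE mulmxA TE.
have tV B v : v \in V -> t B v \in V.
  move=> vV; suff : (V <= t B @^-1: V)%VS.
    by move=> /subvP/(_ _ vV); rewrite memv_preim.
  by apply: lin_span_sub => _ [_ [a _ <-] [u _ <-]]; rewrite -memv_preim tF.
(* [T] acts on all of C^k, but the module laws hold only on [V]; they are checked on its
   generators. *)
have ext (g h : 'End('cV[Cplx R]_k)) :
    (forall a v, g (F a *m v) = h (F a *m v)) -> {in V, g =1 h}.
  move=> gh v vV; apply/eqP; rewrite -subr_eq0 -opp_lfunE -add_lfunE -memv_ker.
  suff : (V <= lker (g - h))%VS by move=> /subvP/(_ _ vV).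
  apply: lin_span_sub => _ [_ [a _ <-] [u _ <-]].
  by rewrite memv_ker add_lfunE opp_lfunE gh subrr.
have t1 v : v \in V -> t 1%:M v = v.
  move=> vV; rewrite -[RHS]id_lfunE; apply: ext vV => a {}v.
  by rewrite tF id_lfunE; congr (F _ *m _); apply: C0P => x; rewrite /= mul1mx.
have tM A B v : v \in V -> t (A *m B) v = t A (t B v).
  move=> vV; rewrite -comp_lfunE; apply: ext vV => a {}v.
  rewrite comp_lfunE !tF; congr (F _ *m _).
  by apply: C0P => x; rewrite /= mulmxA.
have tsum I (s : seq I) A v :
    t (\sum_(i <- s) A i) v = \sum_(i <- s) t (A i) v.
  by rewrite tE Tsum mulmx_suml; apply: eq_bigr => i _; rewrite tE.
exists (\dim (t (delta_mx 0 0) @: V)); split.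
  exact: dim_matrix_module tsum.
move=> d L M; apply: leq_trans (dim_rank1_image tV tM tsum L M).
apply/dimvS/lin_span_sub => _ [a _ [v _ <-]].
by rewrite -tF; exact/memv_img/VF.
Qed.

Lemma rank_G_comp (R : realType) (k l m : nat) (X Y : finCW R)
    (f : G R k l.+1 X) (g : G R l.+1 m.+1 Y) :
  (G_rank (G_comp (f, g)) <= G_rank f * G_rank g)%N.
Proof.
have [w [dimf spanf]] := dim_G_space f.
have [s [dimg _]] := dim_G_space g.
rewrite /G_rank dimf dimg !mulKn //.
set U := G_space g in dimg; pose e := vbasis U.
(* Basis vectors of V_g and their coordinate forms: the sum of the [L i *m M i] is the matrix P that
   fixes V_g. *)
pose L (i : 'I_(\dim U)) : 'cV_l.+1 := e`_i.
pose M (i : 'I_(\dim U)) : 'rV_l.+1 := \row_j coord e i (delta_mx j 0).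
have PU v : v \in U -> (\sum_i L i *m M i) *m v = v.
  move=> vU; rewrite [RHS](coord_vbasis vU) mulmx_suml; apply: eq_bigr => i _.
  have -> : coord e i v = (M i *m v) 0 0.
    rewrite {1}[v]matrix_sum_delta linear_sum mxE; apply: eq_bigr => j _.
    by rewrite big_ord1 linearZ mxE mulrC.
  by rewrite -mulmxA {1}[M i *m v]mx11_scalar mul_mx_scalar.
(* Writing [w * s] as a quotient by [m.+1] leaves a comparison of dimensions, with bound
   [\dim U * w]. *)
rewrite -(mulKn (w * s) (ltn0Sn m)) leq_div2r //.
rewrite mulnCA [(w * _)%N]mulnC -dimg.
apply: leq_trans (spanf _ L M); apply/dimvS/lin_spanS.
move=> _ [_ [h _ <-] [v _ <-]]; exists (C0_map g h) => //; exists v => //.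
(* P is inserted column by column: each column of a value of [g] lies in V_g. *)
congr (G_fun f _ *m _); apply: C0P => x /=; apply/trmx_inj/row_matrixP => j.
rewrite -!tr_col !(@colE (Cplx R)) -mulmxA PU //; apply: mem_lin_span.
exists (G_fun g (C0_slice h x)); first by exists (C0_slice h x).
by exists (delta_mx j 0).
Qed.

(** * Equicontinuity and joint continuity of composition *)

(** [d] inverts the constant of [star_hom_norm_le], so one [d] serves all [F]. *)
Lemma G_equicontinuous (R : realType) (Z : ptopologicalType) n p
    (eps : Cplx R) : 0 < eps ->
  exists2 d : Cplx R, 0 < d & forall (F : G R n p Z) (b : C0 R Z p),
    (forall x i j, `|b x i j| <= d) -> forall i j, `|G_fun F b i j| <= eps.
Proof.
move=> e0; exists (p.+1%:R^-1 * (n.+1%:R^-1 * eps)) => [|F b bd i j].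
  by rewrite !mulr_gt0 ?invr_gt0 ?ltr0n.
apply: le_trans (star_hom_norm_le (G_star_hom F) _ bd i j) _.
  by rewrite !mulr_gt0 ?invr_gt0 ?ltr0n.
by rewrite !mulVKf ?pnatr_eq0.
Qed.

Section Continuity.
Variables (R : realType) (k l m : nat) (X Y : finCW R).

(** Writing h_x for the slice at x, g(h_x) - g0(h_x) is g(h_x - h_x0) + (g - g0)(h_x0) - g0(h_x -
    h_x0), and each term is at most a third of [eps] for x near x0 and g near g0. Compactness of [X]
    makes this uniform in x. *)
Lemma C0_map_unif (h : C0 R (smash X Y) m) (g0 : G R l m Y) (eps : Cplx R) :
  0 < eps -> \forall g \near g0, forall x i j,
    `|(C0_map (X := X) g h - C0_map g0 h) x i j| <= eps.
Proof.
move=> e0; have e3 : 0 < eps / 3%:R by rewrite divr_gt0 ?ltr0n.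
have [d d0 gd] := G_equicontinuous Y l m e3.
have ncX : near_covering [set: X].
  by apply/compact_near_coveringP; exact: compact_finCW.
pose close g x := forall i j,
  `|(C0_map (X := X) g h - C0_map g0 h) x i j| <= eps.
have nearg : \forall g \near g0, [set: X] `<=` close g.
  apply: (ncX _ (nbhs g0) close) => x0 _.
  pose gclose g := forall i j,
    `|(G_fun g (C0_slice h x0) - G_fun g0 (C0_slice h x0)) i j| <= eps / 3%:R.
  have gx0 : \forall g \near g0, gclose g.
    apply: (@filter_forall _ _ _ (nbhs g0) (nbhs_filter _)) => i.
    apply: (@filter_forall _ _ _ (nbhs g0) (nbhs_filter _)) => j.
    have /cvgrPdist_lt/(_ _ e3) := @continuous_entry _ _ _ _ _ i j
      (@G_eval_continuous R l m Y (C0_slice h x0)) g0.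
    by apply: filterS => g /ltW; rewrite distrC !mxE.
  have sx0 := C0_slice_unif h x0 d0.
  exists ((fun x => forall y i j, `|(C0_slice h x - C0_slice h x0) y i j| <= d),
    gclose); first by split.
  move=> [x g] [/= hx hg] i j.
  have -> : (C0_map g h - C0_map g0 h : C0 R X l) x i j =
      G_fun g (C0_slice h x - C0_slice h x0) i j +
      (G_fun g (C0_slice h x0) - G_fun g0 (C0_slice h x0)) i j -
      G_fun g0 (C0_slice h x - C0_slice h x0) i j.
    transitivity ((C0_map (X := X) g h x - C0_map g0 h x) i j) => //.
    rewrite !(star_homB (G_star_hom _)) !mxE /=.
    by rewrite addrA subrK opprB addrA subrK.
  apply: le_trans (ler_normB _ _) _.
  apply: (@le_trans _ _ (eps / 3%:R + eps / 3%:R + eps / 3%:R)); last first.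
    by rewrite -!mulrDl -{1 2 3}[eps]mulr1 -!mulrDr -!natr1 add0r mulfK.
  apply: lerD; last exact: gd.
  by apply: le_trans (ler_normD _ _) _; apply: lerD; [exact: gd|exact: hg].
by apply: filterS nearg => g H x i j; exact: H.
Qed.

(** The error splits as (f0 - f)(C_0(X, g0) h) - f(C_0(X, g) h - C_0(X, g0) h). As [f] varies in the
    second term, equicontinuity is what controls it. *)
Lemma G_comp_continuous : continuous (@G_comp R k l m X Y).
Proof.
apply: G_continuous => h -[f0 g0]; apply: mx_cvg => i j.
apply/cvgrPdist_le => eps e0.
have e2 : 0 < eps / 2%:R by rewrite divr_gt0 ?ltr0n.
have [d d0 fd] := G_equicontinuous X k l e2.
have nearf : \forall f \near f0,
    `|(G_fun f0 (C0_map g0 h) - G_fun f (C0_map g0 h)) i j| <= eps / 2%:R.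
  have /cvgrPdist_lt/(_ _ e2) := @continuous_entry _ _ _ _ _ i j
    (@G_eval_continuous R k l X (C0_map g0 h)) f0.
  by apply: filterS => f /ltW; rewrite !mxE.
have nearg := C0_map_unif h g0 d0.
exists ((fun f => `|(G_fun f0 (C0_map g0 h) - G_fun f (C0_map g0 h)) i j|
    <= eps / 2%:R : Prop),
  (fun g => forall x i j, `|(C0_map (X := X) g h - C0_map g0 h) x i j| <= d)).
  by split.
move=> [f g] [/= hf hg].
have -> : G_fun f0 (C0_map g0 h) i j - G_fun f (C0_map g h) i j =
   (G_fun f0 (C0_map g0 h) - G_fun f (C0_map g0 h)) i j -
   G_fun f (C0_map g h - C0_map g0 h) i j.
  by rewrite (star_homB (G_star_hom _)) !mxE opprB addrA subrK.
apply: le_trans (ler_normB _ _) _; rewrite [eps in leRHS]splitr.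
by apply: lerD => //; exact: fd.
Qed.

End Continuity.

(** * The restricted composition map and its naturality *)

Lemma continuous_pair_map (A A' B B' : topologicalType)
    (f : A -> A') (g : B -> B') :
  continuous f -> continuous g -> continuous (fun p => (f p.1, g p.2)).
Proof.
move=> cf cg p; apply: cvg_pair => /=.
  by apply: (@continuous_comp _ _ _ fst f); [exact: cvg_fst|exact: cf].
by apply: (@continuous_comp _ _ _ snd g); [exact: cvg_snd|exact: cg].
Qed.

Section RankComposition.
Variables (R : realType) (k l m r s : nat) (X Y : finCW R).

Lemma Gr_comp_rank (p : Gr R k l.+1 r X * Gr R l.+1 m.+1 s Y) :
  (G_rank (G_comp (Gr_incl p.1, Gr_incl p.2)) <= r * s)%N.
Proof.
by apply: leq_trans (rank_G_comp _ _) _; rewrite leq_mul ?Gr_rank.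
Qed.

Definition Gr_comp (p : Gr R k l.+1 r X * Gr R l.+1 m.+1 s Y) :
  Gr R k m.+1 (r * s) (smash X Y) := mkGr (Gr_comp_rank p).

Lemma Gr_comp_wedge p : in_wedge p -> Gr_comp p = point.
Proof.
move=> wp; apply: Gr_incl_inj; apply: G_comp_wedge.
by case/orP: wp => /eqP E; apply/orP; [left|right]; apply/eqP;
  rewrite /= E; exact: (pointed_map_point Gr_incl).
Qed.

Lemma Gr_comp_continuous : continuous Gr_comp.
Proof.
apply: Gr_continuous => p.
apply: (@continuous_comp _ _ _
  (fun p : Gr R k l.+1 r X * Gr R l.+1 m.+1 s Y => (Gr_incl p.1, Gr_incl p.2))
  (@G_comp R k l.+1 m.+1 X Y)); last exact: G_comp_continuous.
apply: continuous_pair_map; exact: pointed_map_continuous.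
Qed.

Lemma Gr_comp_smash_point : smash_lift Gr_comp point = point.
Proof.
rewrite [LHS](smash_liftE Gr_comp_wedge (point, point)).
by apply: Gr_comp_wedge; rewrite /in_wedge eqxx.
Qed.

Definition Gr_comp_smash :
    pointed_map (smash (Gr R k l.+1 r X) (Gr R l.+1 m.+1 s Y))
      (Gr R k m.+1 (r * s) (smash X Y)) :=
  PointedMap (smash_lift_continuous Gr_comp_wedge Gr_comp_continuous)
    Gr_comp_smash_point.

Lemma Gr_comp_smashE p : Gr_comp_smash (smash_pair p) = Gr_comp p.
Proof. exact: smash_liftE Gr_comp_wedge p. Qed.

End RankComposition.

(** Both sides apply [g] and then [f] to the function sending (x, y) to h(u(x) /\ v(y)). *)
Lemma G_comp_natural (R : realType) (k l m : nat) (X X' Y Y' : finCW R)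
    (u : pointed_map X X') (v : pointed_map Y Y')
    (f : G R k l X) (g : G R l m Y) :
  G_comp (G_map k l u f, G_map l m v g) =
  G_map k m (smash_map u v) (G_comp (f, g)).
Proof.
apply: G_eq => h; congr (G_fun f _); apply: C0P => x; congr (G_fun g _).
apply: C0P => y; congr (h _); exact/esym/(smash_mapE u v (x, y)).
Qed.

Theorem proposition3p7 (R : realType) (k l m : nat)
    (k_gt0 : (0 < k)%N) (l_gt0 : (0 < l)%N) (m_gt0 : (0 < m)%N) (r s : nat) :
  exists c : forall X Y : finCW R,
      pointed_map (smash (Gr R k l r X) (Gr R l m s Y)) (Gr R k m (r * s) (smash X Y)),
    (forall (X Y : finCW R) (z : smash (Gr R k l r X) (Gr R l m s Y)),
       Gr_incl (c X Y z) = G_comp_smash (smash_map Gr_incl Gr_incl z)) /\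
    (forall (X X' Y Y' : finCW R) (u : pointed_map X X') (v : pointed_map Y Y')
            (z : smash (Gr R k l r X) (Gr R l m s Y)),
       c X' Y' (smash_map (Gr_map k l r u) (Gr_map l m s v) z) =
       Gr_map k m (r * s) (smash_map u v) (c X Y z)).
Proof.
(* Successor sizes provide the index 0 for matrix units and a nonzero divisor in the rank. *)
case: l m l_gt0 m_gt0 => [//|l] [//|m] _ _.
exists (fun X Y => Gr_comp_smash k l m r s X Y); split=> [X Y|X X' Y Y' u v].
  by apply: smash_ind => -[f g]; rewrite smash_mapE G_comp_smashE Gr_comp_smashE.
apply: smash_ind => -[f g]; rewrite smash_mapE !Gr_comp_smashE.
by apply: Gr_incl_inj; exact: G_comp_natural.
Qed.
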